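(* Let $p$ be a prime and $0\le a\le b$ integers. Every regular dessin $\mathcal{A}=(G,x,y)$ with $G\cong\mathbb{Z}_{p^a}\oplus\mathbb{Z}_{p^b}$ and $o(x)=p^b$ is isomorphic to the dessin $(G,x,y)$ with $G$ given by the presentation $$G=\langle x,y\mid x^{p^b}=y^{p^{a+c}}=[x,y]=1,\ y^{p^a}=x^{ep^{b-c}}\rangle$$ for some pair $(c,e)$ of integers with $0\le c\le b-a$ and $e\in\mathbb{Z}_{p^c}^*$; two dessins given by pairs $(c_1,e_1)$ and $(c_2,e_2)$ are isomorphic if and only if $c_1=c_2$ and $e_1\equiv e_2\pmod{p^{c_1}}$. Consequently, up to the duality swapping the black and white vertices (i.e. $(G,x,y)\mapsto(G,y,x)$), the isomorphism classes of regular dessins with automorphism group isomorphic to $\mathbb{Z}_{p^a}\oplus\mathbb{Z}_{p^b}$ are in one-to-one correspondence with the pairs $(c,e)$ satisfying $0\le c\le b-a$ and $e\in\mathbb{Z}_{p^c}^*$.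
   Context: A regular dessin is a triple $(G,x,y)$ with $G$ a finite group generated by $x,y$, whose automorphism group is identified with $G$; $(G_1,x_1,y_1)\cong(G_2,x_2,y_2)$ if $x_1\mapsto x_2$, $y_1\mapsto y_2$ extends to a group isomorphism. $o(x)$ is the order of $x$, $\mathbb{Z}_{p^c}^*$ the unit group of $\mathbb{Z}_{p^c}$.
   Formalization: Classes modulo duality are not in bijection with the pairs (p=5, a=0, b=1: 5 pairs, 4 classes), so the last clause is proved as: pairs biject with isomorphism classes having o(x)=p^b, and every dessin with this group, or its dual, is isomorphic to one of these. *)

(* Defs.v *)
From HB Require Import structures.
From mathcomp Require Import all_boot all_order all_fingroup all_algebra.

Set Implicit Arguments.
Unset Strict Implicit.
Unset Printing Implicit Defensive.

Local Open Scope group_scope.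

Record dessin := Dessin {
  dessin_gT : finGroupType;
  dessin_group : {group dessin_gT};
  dessin_x : dessin_gT;
  dessin_y : dessin_gT;
  dessin_gen : <<[set dessin_x; dessin_y]>> = dessin_group }.

Definition dessin_iso (D1 D2 : dessin) : Prop :=
  exists f : {morphism dessin_group D1 >-> dessin_gT D2},
    [/\ isom (dessin_group D1) (dessin_group D2) f,
        f (dessin_x D1) = dessin_x D2 & f (dessin_y D1) = dessin_y D2].

Lemma dual_gen (D : dessin) :
  <<[set dessin_y D; dessin_x D]>> = dessin_group D.
Proof. by rewrite setUC dessin_gen. Qed.

Definition dual (D : dessin) : dessin := Dessin (dual_gen D).

(* [Zp n] rather than ['Z_n], since ['Z_1] is the ring with two elements,    *)
(* whereas [Zp 1] is the trivial group; the case a = 0 matters.              *)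
Definition has_group_type (p a b : nat) (D : dessin) : Prop :=
  dessin_group D \isog setX (Zp (p ^ a)) (Zp (p ^ b)).

Definition expgz (gT : groupType) (g : gT) (z : int) : gT :=
  match z with Posz n => g ^+ n | Negz n => g ^- n.+1 end.

(* [D] is the group presented by the generators x, y and the relations [R],  *)
(* with its marked generators: x and y satisfy [R], and every pair of        *)
(* elements satisfying [R] in a possibly infinite group is the image of      *)
(* (x, y) under a homomorphism. The presentations of the presentation        *)
(* library do not keep track of the generators.                              *)
Definition presented_by (R : forall gT : groupType, gT -> gT -> Prop)
    (D : dessin) : Prop :=
  R (dessin_gT D) (dessin_x D) (dessin_y D) /\
  forall (hT : groupType) (u v : hT), R hT u v ->
    exists f : dessin_gT D -> hT,
      [/\ {in dessin_group D &, {morph f : g h / g * h}},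
          f (dessin_x D) = u & f (dessin_y D) = v].

Definition ce_relations (p a b c : nat) (e : int) (gT : groupType) (x y : gT)
    : Prop :=
  [/\ x ^+ (p ^ b) = 1, y ^+ (p ^ (a + c)) = 1, [~ x, y] = 1
    & y ^+ (p ^ a) = expgz x (e * (p ^ (b - c))%N%:Z)%R].

Definition given_by (p a b c : nat) (e : int) (D : dessin) : Prop :=
  presented_by (ce_relations p a b c e) D.

(* Pairs (c, e) with e an integer representing a class in the unit group of  *)
(* the integers modulo p ^ c.                                                *)
Definition ce_valid (p a b c : nat) (e : int) : bool :=
  (c <= b - a)%N && coprimez e (p ^ c)%N%:Z.

(* The finite type of pairs (c, e) with e a residue class. For c = 0 the     *)
(* ring ['Z_1] has two elements but a single unit, so [{unit 'Z_1}] has, as  *)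
(* it should, exactly one element.                                           *)
Definition ce_pair (p a b : nat) : Type :=
  {c : 'I_(b - a).+1 & {unit 'Z_(p ^ c)}}.

Definition pair_c (p a b : nat) (q : ce_pair p a b) : nat := tag q.

Definition pair_e (p a b : nat) (q : ce_pair p a b) : int :=
  Posz (nat_of_ord (FinRing.uval (tagged q))).

(* [F] induces a bijection from [I] onto the isomorphism classes of dessins  *)
(* in [S].                                                                   *)
Definition classifies (S : dessin -> Prop) (I : Type) (F : I -> dessin)
    : Prop :=
  (forall i, S (F i)) /\ (forall D, S D -> exists! i, dessin_iso D (F i)).

(* Main.v *)
(* If x has order p^b in G = Z_{p^a} + Z_{p^b}, then G / <x> is cyclic of     *)
(* order p^a, generated by the image of y, so y^(p^a) is a power of x; its    *)
(* order p^c divides p^(b-a) because G has exponent p^b, and it then equals   *)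
(* x^(e p^(b-c)) with e prime to p^c. The relations reduce every element to   *)
(* the form x^i y^j with i < p^b and j < p^a, so any group of order p^(a+b)   *)
(* satisfying them is the presented one; (0, 1) and (1, e p^(b-c-a)) in       *)
(* Z_{p^a} + Z_{p^b} realise every pair (c, e). The order of y^(p^a) and the  *)
(* exponent of x expressing it recover c and e modulo p^c. Finally one of the *)
(* two generators of G has order p^b, the exponent of G.                      *)

Require Import Defs.
From HB Require Import structures.
From mathcomp Require Import all_boot all_order all_fingroup all_algebra.
From mathcomp Require Import cyclic.

Set Implicit Arguments.
Unset Strict Implicit.
Unset Printing Implicit Defensive.

Local Open Scope group_scope.

(** The existence half reads (c, e) off the quotient by <x>; the rest rests on a count. The
    relations rewrite every product x^i y^j to one with i < p^b and j < p^a. If the group has order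
    p^(a+b), there is no room for two such forms to coincide, so an equality between products x^i
    y^j follows from the relations alone and holds in every group satisfying them. Hence x^i y^j |->
    u^i v^j is a well-defined homomorphism ([expgM2_inj], [extend_generators]), and a dessin of
    order p^(a+b) satisfying the relations is presented by them ([given_by_card]).

    Presented dessins are unique up to isomorphism ([presented_by_iso]). So [has_group_type_ce],
    which finds (c, e) in a given dessin, [ce_dessin], which realises each pair, and
    [ce_relations_inj], which recovers c and e mod p^c inside one group, together give the
    classification. Duality enters through [has_group_type_order_max]: one of the two generators
    attains the exponent p^b. *)

(** * Integer exponents and orders of powers of x *)

Lemma expg_modn (gT : groupType) (x : gT) (n i : nat) :
  x ^+ n = 1 -> x ^+ (i %% n) = x ^+ i.
Proof.
by move=> xn1; rewrite {2}(divn_eq i n) expgD mulnC expgM xn1 expg1n mul1g.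
Qed.

Lemma expgz_mod (gT : groupType) (x : gT) (n : nat) (z : int) :
  (0 < n)%N -> x ^+ n = 1 -> expgz x z = x ^+ `|(z %% n%:Z)%Z|%N.
Proof.
move=> n_gt0 xn1.
have xnm m : x ^+ (m * n) = 1 by rewrite mulnC expgM xn1 expg1n.
case: z => m /=; first by rewrite modz_nat absz_nat expg_modn.
(* For a negative exponent -(m+1) with residue r, multiplying by x^(m+1) reduces the claim to
   x^(m+1+r) = 1, that is, to n dividing m+1+r. *)
apply: (@mulgI _ (x ^+ m.+1)); rewrite mulgV -expgD.
have n0 : (n%:Z != 0)%R by rewrite eqz_nat -lt0n.
have /dvdnP[q ->] : (n %| m.+1 + `|(Negz m %% n%:Z)%Z|)%N; last by rewrite xnm.
suff : (n%:Z %| (m.+1 + `|(Negz m %% n%:Z)%Z|)%N%:Z)%Z by [].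
rewrite PoszD gez0_abs ?modz_ge0 // dvdzE.
have := divz_eq (Negz m) (Posz n).
set r := (_ %% _)%Z; set q := (_ %/ _)%Z => def_m.
have -> : (m.+1%:Z + r = - q * n%:Z)%R.
  rewrite NegzE in def_m; rewrite -[Posz m.+1]GRing.opprK def_m.
  by rewrite GRing.opprD GRing.addrNK GRing.mulNr.
by rewrite -dvdzE dvdz_mull.
Qed.

Lemma modz_mul_pexp (p b c : nat) (e : int) : (c <= b)%N ->
  ((e * (p ^ (b - c))%N%:Z) %% (p ^ b)%N%:Z)%Z
    = ((e %% (p ^ c)%N%:Z)%Z * (p ^ (b - c))%N%:Z)%R.
Proof.
move=> le_cb; rewrite -{2}(subnKC le_cb) expnD PoszM.
case: (posnP (p ^ (b - c))) => [->|lt0]; first by rewrite !GRing.mulr0 mod0z.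
by rewrite mulz_modl.
Qed.

(** As x^(p^b) = 1, only e mod p^c matters. The last relation thereby takes the form y^m = x^k with
    natural k, to which the normal forms apply. *)
Lemma expgz_pexp (gT : groupType) (x : gT) (p b c : nat) (e : int) :
  (0 < p)%N -> (c <= b)%N -> x ^+ (p ^ b) = 1 ->
  expgz x (e * (p ^ (b - c))%N%:Z)%R
    = x ^+ (`|(e %% (p ^ c)%N%:Z)%Z| * p ^ (b - c)).
Proof.
move=> p_gt0 le_cb xb1; rewrite (expgz_mod _ _ xb1) ?expn_gt0 ?p_gt0 //.
by rewrite modz_mul_pexp // abszM absz_nat.
Qed.

(** Used both ways: a unit e gives order exactly p^c, and order p^c forces e to be a unit. *)
Lemma order_expg_pexp (gT : finGroupType) (x : gT) (p b c e : nat) :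
  (0 < p)%N -> (c <= b)%N -> #[x] = (p ^ b)%N ->
  #[x ^+ (e * p ^ (b - c))] = (p ^ c %/ gcdn (p ^ c) e)%N.
Proof.
move=> p_gt0 le_cb ox; rewrite orderXgcd ox -{1 2}(subnK le_cb) expnD.
by rewrite [(e * _)%N]mulnC -muln_gcdr divnMl ?expn_gt0 ?p_gt0.
Qed.

(** * Normal forms x^i y^j and the homomorphisms they define *)

(** This is carrying: in y^j = (y^m)^(j/m) y^(j mod m) the first factor is a power of x, absorbed by
    x^i. *)
Lemma expgM2_reduce (gT : groupType) (x y : gT) (n m k i j : nat) :
  x ^+ n = 1 -> y ^+ m = x ^+ k ->
  x ^+ i * y ^+ j = x ^+ ((i + k * (j %/ m)) %% n) * y ^+ (j %% m).
Proof.
move=> xn1 ym; rewrite {1}(divn_eq j m) expgD [(_ %/ _ * m)%N]mulnC expgM ym.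
by rewrite -expgM mulgA -expgD expg_modn.
Qed.

Lemma mem_gen2P (gT : finGroupType) (x y g : gT) : commute x y ->
  reflect (exists i j, g = x ^+ i * y ^+ j) (g \in <<[set x; y]>>).
Proof.
move=> cxy; apply: (iffP idP) => [|[i [j ->]]]; last first.
  by rewrite groupM // groupX // mem_gen // !inE eqxx ?orbT.
rewrite -[<<_>>]/([set x] <*> [set y]) -joing_idl -joing_idr.
rewrite comm_joingE; last first.
  by apply: centC; rewrite cent_cycle cycle_subG; apply/cent1P.
by case/mulsgP=> _ _ /cycleP[i ->] /cycleP[j ->] ->; exists i, j.
Qed.

(** The n m reduced pairs map onto a group with n m elements, so the map is injective and normal
    forms are unique. *)
Lemma expgM2_inj (gT : finGroupType) (x y : gT) (n m k : nat) :
    (0 < n)%N -> (0 < m)%N -> commute x y ->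
    x ^+ n = 1 -> y ^+ m = x ^+ k -> #|<<[set x; y]>>| = (n * m)%N ->
  forall i j i' j', x ^+ i * y ^+ j = x ^+ i' * y ^+ j' ->
    (i + k * (j %/ m) = i' + k * (j' %/ m) %[mod n])%N /\ (j = j' %[mod m])%N.
Proof.
move=> n_gt0 m_gt0 cxy xn1 ym oG i j i' j'.
pose h (s : 'I_n * 'I_m) := x ^+ s.1 * y ^+ s.2.
have hG : h @: [set: 'I_n * 'I_m] = <<[set x; y]>>.
  apply/setP=> g; apply/imsetP/(mem_gen2P _ cxy) => [[[s t] _ ->]|[s [t ->]]].
    by exists s, t.
  exists (Ordinal (ltn_pmod (s + k * (t %/ m)) n_gt0),
          Ordinal (ltn_pmod t m_gt0)) => //.
  exact: expgM2_reduce.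
have /imset_injP hI : #|h @: [set: 'I_n * 'I_m]| == #|[set: 'I_n * 'I_m]|.
  by rewrite hG oG cardsT card_prod !card_ord.
rewrite (expgM2_reduce i j xn1 ym) (expgM2_reduce i' j' xn1 ym) => eq_h.
pose r s t := (Ordinal (ltn_pmod (s + k * (t %/ m)) n_gt0),
               Ordinal (ltn_pmod t m_gt0)).
by case: (hI (r i j) (r i' j') (in_setT _) (in_setT _) eq_h).
Qed.

(** Equal elements have the same normal form, and u, v obey the same reduction rule as x, y. *)
Lemma expgM2_transfer (gT : finGroupType) (x y : gT)
    (hT : groupType) (u v : hT) (n m k : nat) :
    (0 < n)%N -> (0 < m)%N -> commute x y ->
    x ^+ n = 1 -> y ^+ m = x ^+ k -> #|<<[set x; y]>>| = (n * m)%N ->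
    u ^+ n = 1 -> v ^+ m = u ^+ k ->
  forall i j i' j', x ^+ i * y ^+ j = x ^+ i' * y ^+ j' ->
    u ^+ i * v ^+ j = u ^+ i' * v ^+ j'.
Proof.
move=> n_gt0 m_gt0 cxy xn1 ym oG un1 vm i j i' j'.
case/(expgM2_inj n_gt0 m_gt0 cxy xn1 ym oG) => eqi eqj.
by rewrite (expgM2_reduce i j un1 vm) (expgM2_reduce i' j' un1 vm) eqi eqj.
Qed.

Lemma extend_generators (D : dessin) (hT : groupType) (u v : hT)
    (n m k : nat) :
    let x := dessin_x D in let y := dessin_y D in
    (0 < n)%N -> (0 < m)%N -> commute x y ->
    x ^+ n = 1 -> y ^+ m = x ^+ k -> #|dessin_group D| = (n * m)%N ->
    commute u v -> u ^+ n = 1 -> v ^+ m = u ^+ k ->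
  exists f : dessin_gT D -> hT,
    [/\ {in dessin_group D &, {morph f : g h / g * h}}, f x = u & f y = v].
Proof.
move=> x y n_gt0 m_gt0 cxy xn1 ym.
rewrite -dessin_gen -/x -/y => oG cuv un1 vm.
have tr := expgM2_transfer n_gt0 m_gt0 cxy xn1 ym oG un1 vm.
(* The implication makes the existence hold for all g, so that [xchoose] yields a total function;
   outside the group its value is arbitrary. *)
have ex_ij g : exists ij : nat * nat,
    (g \in <<[set x; y]>>) ==> (g == x ^+ ij.1 * y ^+ ij.2).
  case: (boolP (g \in _)) => [/(mem_gen2P _ cxy)[i [j ->]]|_].
    by exists (i, j) => /=.
  by exists (0, 0)%N.
pose ij g := xchoose (ex_ij g).
have ijP g : g \in <<[set x; y]>> -> x ^+ (ij g).1 * y ^+ (ij g).2 = g.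
  by move=> Gg; have /implyP/(_ Gg)/eqP := xchooseP (ex_ij g).
pose f g := u ^+ (ij g).1 * v ^+ (ij g).2.
have fE i j : f (x ^+ i * y ^+ j) = u ^+ i * v ^+ j.
  by apply: tr; rewrite ijP //; apply/mem_gen2P => //; exists i, j.
have mulE (kT : groupType) (s t : kT) i j i' j' : commute s t ->
    s ^+ i * t ^+ j * (s ^+ i' * t ^+ j') = s ^+ (i + i') * t ^+ (j + j').
  move=> cst; rewrite !expgD -!mulgA; congr (_ * _); rewrite !mulgA.
  congr (_ * _); apply/esym; exact: (commuteX2 i' j cst).
exists f; split.
- move=> g h /ijP eg /ijP eh.
  by rewrite -[in LHS]eg -[in LHS]eh mulE // fE -mulE.
- by have := fE 1%N 0%N; rewrite !expg1 !expg0 !mulg1.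
- by have := fE 0%N 1%N; rewrite !expg1 !expg0 !mul1g.
Qed.

(** * Presented dessins, and recovering c and e *)

Lemma ce_relations_eqmod (p a b c : nat) (e1 e2 : int) (gT : groupType)
    (x y : gT) :
  (0 < p)%N -> (c <= b)%N -> (e1 = e2 %[mod (p ^ c)%N%:Z])%Z ->
  ce_relations p a b c e1 x y -> ce_relations p a b c e2 x y.
Proof.
move=> p_gt0 le_cb eq_e [xb1 ya1 xy1 rel]; split=> //.
by rewrite rel !expgz_pexp // eq_e.
Qed.

Lemma presented_by_equiv (R S : forall gT : groupType, gT -> gT -> Prop)
    (D : dessin) :
  (forall (gT : groupType) (x y : gT), R gT x y <-> S gT x y) ->
  presented_by R D -> presented_by S D.
Proof.
by move=> RS [RD univ]; split=> [|hT u v /RS]; [apply/RS | apply: univ].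
Qed.

Lemma given_by_eqmod (p a b c : nat) (e1 e2 : int) (D : dessin) :
  (0 < p)%N -> (c <= b)%N -> (e1 = e2 %[mod (p ^ c)%N%:Z])%Z ->
  given_by p a b c e1 D -> given_by p a b c e2 D.
Proof.
move=> p_gt0 le_cb eq_e; apply: presented_by_equiv => gT x y.
by split; apply: ce_relations_eqmod.
Qed.

Lemma given_by_card (p a b c : nat) (e : int) (D : dessin) :
  (0 < p)%N -> (c <= b)%N -> #|dessin_group D| = (p ^ b * p ^ a)%N ->
  ce_relations p a b c e (dessin_x D) (dessin_y D) -> given_by p a b c e D.
Proof.
move=> p_gt0 le_cb oG relD; split=> // hT u v [ub1 _ cuv rel_v].
case: relD => xb1 _ cxy rel_y; rewrite expgz_pexp // in rel_v.
rewrite expgz_pexp // in rel_y.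
have p_exp_gt0 n : (0 < p ^ n)%N by rewrite expn_gt0 p_gt0.
apply: (extend_generators _ _ _ xb1 rel_y oG _ ub1 rel_v) => //.
  by apply/commgP/eqP.
by apply/commgP/eqP.
Qed.

Lemma morphim_dessin (D1 D2 : dessin)
    (f : {morphism dessin_group D1 >-> dessin_gT D2}) :
  f (dessin_x D1) = dessin_x D2 -> f (dessin_y D1) = dessin_y D2 ->
  f @* dessin_group D1 = dessin_group D2.
Proof.
move=> fx fy; have sG : [set dessin_x D1; dessin_y D1] \subset dessin_group D1.
  by rewrite -(dessin_gen D1) subset_gen.
rewrite -[X in f @* X](dessin_gen D1) morphim_gen // morphimEsub //.
by rewrite imsetU1 imset_set1 fx fy dessin_gen.
Qed.

(** Universality gives homomorphisms both ways. Each is onto because it hits both generators, so the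
    finite groups have equal order and the maps are bijective. *)
Lemma presented_by_iso (R : forall gT : groupType, gT -> gT -> Prop)
    (D1 D2 : dessin) :
  presented_by R D1 -> presented_by R D2 -> dessin_iso D1 D2.
Proof.
move=> [R1 univ1] [R2 univ2].
have [f1 [f1M f1x f1y]] := univ1 _ _ _ R2.
have [f2 [f2M f2x f2y]] := univ2 _ _ _ R1.
pose m1 := Morphism f1M; pose m2 := Morphism f2M.
have im1 : m1 @* dessin_group D1 = dessin_group D2 by apply: morphim_dessin.
have im2 : m2 @* dessin_group D2 = dessin_group D1 by apply: morphim_dessin.
exists m1; split=> //; apply/isomP; split=> //.
rewrite -card_im_injm eqn_leq leq_morphim -{1}im2 im1; exact: leq_morphim.
Qed.

Lemma mem_dessin_x (D : dessin) : dessin_x D \in dessin_group D.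
Proof. by rewrite -dessin_gen mem_gen ?set21. Qed.

Lemma mem_dessin_y (D : dessin) : dessin_y D \in dessin_group D.
Proof. by rewrite -dessin_gen mem_gen ?set22. Qed.

Lemma order_dessin_iso (D1 D2 : dessin) :
  dessin_iso D1 D2 -> #[dessin_x D1] = #[dessin_x D2].
Proof.
case=> f [/isomP[injf _] <- _]; apply/esym/order_injm => //.
exact: mem_dessin_x.
Qed.

Lemma morph_expgz (aT rT : finGroupType) (G : {group aT})
    (f : {morphism G >-> rT}) (x : aT) (z : int) :
  x \in G -> f (expgz x z) = expgz (f x) z.
Proof. by move=> Gx; case: z => n /=; rewrite ?morphV ?groupX // morphX. Qed.

Lemma ce_relations_iso (p a b c : nat) (e : int) (D1 D2 : dessin) :
  dessin_iso D1 D2 -> ce_relations p a b c e (dessin_x D1) (dessin_y D1) ->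
  ce_relations p a b c e (dessin_x D2) (dessin_y D2).
Proof.
case=> f [_ <- <-] [xb1 ya1 xy1 rel].
have [Gx Gy] := (mem_dessin_x D1, mem_dessin_y D1).
split; first by rewrite -morphX // xb1 morph1.
- by rewrite -morphX // ya1 morph1.
- by rewrite -morphR // xy1 morph1.
- by rewrite -morphX // rel morph_expgz.
Qed.

Lemma coprime_absz_modz (n : nat) (e : int) :
  (0 < n)%N -> coprime n `|(e %% n%:Z)%Z| = coprimez e n%:Z.
Proof.
move=> n_gt0; rewrite coprimez_sym.
rewrite -[coprime _ _]/(coprimez n%:Z (e %% n%:Z)%Z).
by rewrite /coprimez gcdz_modr.
Qed.

(** The order of y^(p^a) is p^c, which determines c; the exponent of x expressing y^(p^a) then
    determines e mod p^c. *)
Lemma ce_relations_inj (p a b c1 c2 : nat) (e1 e2 : int) (gT : finGroupType)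
    (x y : gT) :
    prime p -> #[x] = (p ^ b)%N ->
    ce_valid p a b c1 e1 -> ce_valid p a b c2 e2 ->
    ce_relations p a b c1 e1 x y -> ce_relations p a b c2 e2 x y ->
  c1 = c2 /\ (e1 = e2 %[mod (p ^ c1)%N%:Z])%Z.
Proof.
move=> p_pr ox /andP[le_c1 co1] /andP[le_c2 co2] [xb1 _ _ rel1] [_ _ _ rel2].
have p_gt0 := prime_gt0 p_pr.
have pX_gt0 n : (0 < p ^ n)%N by rewrite expn_gt0 p_gt0.
have {}le_c1 := leq_trans le_c1 (leq_subr _ _).
have {}le_c2 := leq_trans le_c2 (leq_subr _ _).
rewrite expgz_pexp // in rel1; rewrite expgz_pexp // in rel2.
have oy c e : (c <= b)%N -> coprimez e (p ^ c)%N%:Z ->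
    y ^+ (p ^ a) = x ^+ (`|(e %% (p ^ c)%N%:Z)%Z| * p ^ (b - c)) ->
    #[y ^+ (p ^ a)] = (p ^ c)%N.
  move=> le_c co ->; rewrite order_expg_pexp //.
  by rewrite -coprime_absz_modz // in co; rewrite (eqP co) divn1.
have eq_c : c1 = c2.
  apply/eqP; rewrite -(eqn_exp2l _ _ (prime_gt1 p_pr)).
  by rewrite -(oy _ _ le_c1 co1 rel1) -(oy _ _ le_c2 co2 rel2).
split=> //; subst c2; apply/eqP.
have e_ge0 e : (0 <= (e %% (p ^ c1)%N%:Z)%Z)%R.
  by rewrite modz_ge0 // eqz_nat -lt0n.
(* Both exponents lie below p^b, the order of x, so equal powers of x have equal exponents. *)
have lt_e e : (`|(e %% (p ^ c1)%N%:Z)%Z| * p ^ (b - c1) < p ^ b)%N.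
  rewrite -{2}(subnKC le_c1) expnD ltn_pmul2r //.
  by rewrite -ltz_nat gez0_abs // ltz_pmod // ltz_nat.
move: rel2; rewrite rel1 => /eqP; rewrite eq_expg_mod_order ox !modn_small //.
rewrite eqn_pmul2r // => /eqP eq_e.
by rewrite -(gez0_abs (e_ge0 e1)) -(gez0_abs (e_ge0 e2)) eq_e.
Qed.

(** * The model dessins inside Z_{p^a} + Z_{p^b} *)

Lemma expg_pair (gT1 gT2 : finGroupType) (s : gT1) (t : gT2) (n : nat) :
  ((s, t) : gT1 * gT2) ^+ n = (s ^+ n, t ^+ n).
Proof. by elim: n => // n IHn; rewrite !expgS IHn. Qed.

Lemma order_pair1 (gT1 gT2 : finGroupType) (t : gT2) :
  #[((1, t) : gT1 * gT2)] = #[t].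
Proof.
have e1 n : ((1, t) : gT1 * gT2) ^+ n = 1 <-> t ^+ n = 1.
  by rewrite expg_pair expg1n; split=> [[]|->].
apply/eqP; rewrite eqn_dvd !order_dvdn; apply/andP; split; apply/eqP.
  exact/e1/expg_order.
exact/e1/expg_order.
Qed.

(** With x = (1, t) and y = (s, t^k), the element x^-k y = (s, 1) separates the two factors. *)
Lemma gen_setX_cycle (gT1 gT2 : finGroupType) (s : gT1) (t : gT2) (k : nat) :
  <<[set ((1, t) : gT1 * gT2); (s, t ^+ k)]>> = setX <[s]> <[t]>.
Proof.
apply/eqP; rewrite eqEsubset gen_subG; apply/andP; split.
  apply/subsetP=> g; rewrite !inE => /orP[] /eqP -> /=.
    by rewrite group1 cycle_id.
  by rewrite cycle_id mem_cycle.
apply/subsetP=> -[g h]; rewrite !inE /= => /andP[/cycleP[i ->] /cycleP[j ->]].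
set A := [set _; _]; pose x : gT1 * gT2 := (1, t).
pose y : gT1 * gT2 := (s, t ^+ k).
have -> : (s ^+ i, t ^+ j) = (x ^- k * y) ^+ i * x ^+ j.
  have -> : x ^- k * y = (s, 1).
    apply: (@mulgI _ (x ^+ k)); rewrite mulKVg expg_pair expg1n.
    by congr (_, _); rewrite /= ?mul1g ?mulg1.
  by rewrite !expg_pair !expg1n; congr (_, _); rewrite /= ?mul1g ?mulg1.
have [Ax Ay] : x \in <<A>> /\ y \in <<A>> by rewrite !mem_gen ?set21 ?set22.
by rewrite !(groupM, groupX, groupV).
Qed.

(* ['Z_1] has two elements, so [Zp1] does not generate [Zp 1]. *)
Definition Zp_gen (n : nat) : 'Z_n := if (1 < n)%N then Zp1 else 1.

Lemma Zp_gen_cycle (n : nat) : Zp n = <[Zp_gen n]>.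
Proof.
by rewrite /Zp /Zp_gen; case: ifP => _; [apply: Zp_cycle | rewrite cycle1].
Qed.

Lemma order_Zp_gen (n : nat) : (0 < n)%N -> #[Zp_gen n] = n.
Proof. by move=> n_gt0; rewrite /order -Zp_gen_cycle card_Zp. Qed.

Lemma expg_Zp_gen (n : nat) : (0 < n)%N -> Zp_gen n ^+ n = 1.
Proof.
by move=> n_gt0; have := expg_order (Zp_gen n); rewrite order_Zp_gen.
Qed.

(** The exponent is chosen so that raising the second generator to the power p^a kills its first
    coordinate and leaves the e p^(b-c)-th power of the first generator. *)
Lemma ce_dessin_gen (p a b c e : nat) :
  <<[set ((1, Zp_gen (p ^ b)) : 'Z_(p ^ a) * 'Z_(p ^ b));
         (Zp_gen (p ^ a), Zp_gen (p ^ b) ^+ (e * p ^ (b - c - a)))]>>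
    = [group of setX (Zp (p ^ a)) (Zp (p ^ b))].
Proof. by rewrite gen_setX_cycle /= !Zp_gen_cycle. Qed.

Definition ce_dessin (p a b c e : nat) : dessin :=
  Dessin (ce_dessin_gen p a b c e).

Lemma has_group_type_ce_dessin (p a b c e : nat) :
  has_group_type p a b (ce_dessin p a b c e).
Proof. exact: isog_refl. Qed.

Lemma order_ce_dessin (p a b c e : nat) : (0 < p)%N ->
  #[dessin_x (ce_dessin p a b c e)] = (p ^ b)%N.
Proof.
by move=> p_gt0; rewrite /= order_pair1 order_Zp_gen // expn_gt0 p_gt0.
Qed.

Lemma card_has_group_type (p a b : nat) (D : dessin) : (0 < p)%N ->
  has_group_type p a b D -> #|dessin_group D| = (p ^ b * p ^ a)%N.
Proof.
move=> p_gt0 /card_isog ->.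
by rewrite cardsX !card_Zp ?expn_gt0 ?p_gt0 // mulnC.
Qed.

Lemma given_by_ce_dessin (p a b c e : nat) : (0 < p)%N -> (c <= b - a)%N ->
  (a <= b)%N -> given_by p a b c e%:Z (ce_dessin p a b c e).
Proof.
move=> p_gt0 le_c le_ab; have le_cb := leq_trans le_c (leq_subr _ _).
have pX_gt0 n : (0 < p ^ n)%N by rewrite expn_gt0 p_gt0.
apply: given_by_card => //.
  by apply: card_has_group_type => //; apply: has_group_type_ce_dessin.
have oa := expg_Zp_gen (pX_gt0 a).
have ob := expg_Zp_gen (pX_gt0 b).
(* The bound c <= b - a is what keeps the natural subtraction in the model's exponent from
   truncating. *)
have def_bc : (b - c - a + a = b - c)%N by rewrite subnK // leq_subCr.
split=> /=.
- by rewrite expg_pair expg1n ob.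
- rewrite expg_pair expnD expgM oa expg1n -expgM mulnA -(mulnA e) -expnD.
  by rewrite def_bc -mulnA -expnD subnK // mulnC expgM ob expg1n.
- apply/eqP/commgP; congr (_, _); rewrite /= ?mul1g ?mulg1 //.
  exact: commuteX.
- by rewrite !expg_pair expg1n oa -expgM -mulnA -expnD def_bc.
Qed.

(** * Dessins of the given group type *)

Lemma has_group_type_abelian (p a b : nat) (D : dessin) :
  has_group_type p a b D -> abelian (dessin_group D).
Proof.
move/isog_abelian->; rewrite /= !Zp_gen_cycle.
apply/centsP=> -[g1 g2] /setXP[/= Ag Bg] [h1 h2] /setXP[/= Ah Bh].
congr (_, _).
  exact: (centsP (cycle_abelian (Zp_gen (p ^ a)))).
exact: (centsP (cycle_abelian (Zp_gen (p ^ b)))).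
Qed.

Lemma has_group_type_exponent (p a b : nat) (D : dessin) : (0 < p)%N ->
  (a <= b)%N -> has_group_type p a b D ->
  forall g, g \in dessin_group D -> g ^+ (p ^ b) = 1.
Proof.
move=> p_gt0 le_ab /isogP[f injf im_f] g Gg.
have pX_gt0 n : (0 < p ^ n)%N by rewrite expn_gt0 p_gt0.
apply: (injmP injf); rewrite ?groupX // morph1 morphX //.
have: f g \in setX (Zp (p ^ a)) (Zp (p ^ b)) by rewrite -im_f mem_morphim.
case: (f g) => s t /setXP[/= As Bt]; rewrite expg_pair.
rewrite -[X in t ^+ X](card_Zp (pX_gt0 b)) (expg_cardG Bt).
rewrite -(subnKC le_ab) expnD expgM -[X in s ^+ X](card_Zp (pX_gt0 a)).
by rewrite (expg_cardG As) expg1n.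
Qed.

Lemma has_group_type_order (p a b : nat) (D : dessin) : (0 < p)%N ->
  has_group_type p a b D -> exists2 g, g \in dessin_group D & #[g] = (p ^ b)%N.
Proof.
move=> p_gt0; rewrite /has_group_type isog_sym => /isogP[f injf im_f].
have Gx : (1, Zp_gen (p ^ b)) \in setX (Zp (p ^ a)) (Zp (p ^ b)).
  by rewrite inE /= !Zp_gen_cycle group1 cycle_id.
exists (f (1, Zp_gen (p ^ b))); first by rewrite -im_f mem_morphim.
by rewrite order_injm // order_pair1 order_Zp_gen // expn_gt0 p_gt0.
Qed.

Lemma has_group_type_ce (p a b : nat) (D : dessin) : prime p ->
    (a <= b)%N -> has_group_type p a b D -> #[dessin_x D] = (p ^ b)%N ->
  exists c e, ce_valid p a b c e /\ given_by p a b c e D.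
Proof.
move=> p_pr le_ab tD ox; have p_gt0 := prime_gt0 p_pr.
have pX_gt0 n : (0 < p ^ n)%N by rewrite expn_gt0 p_gt0.
have [Gx Gy] := (mem_dessin_x D, mem_dessin_y D).
have cGG := has_group_type_abelian tD; have oG := card_has_group_type p_gt0 tD.
have expG := has_group_type_exponent p_gt0 le_ab tD.
set x := dessin_x D in ox Gx; set y := dessin_y D in Gy.
have cxy : commute x y by apply: (centsP cGG).
have sxG : <[x]> \subset dessin_group D by rewrite cycle_subG.
have nxG : dessin_group D \subset 'N(<[x]>).
  exact: subset_trans cGG (subset_trans (centS sxG) (cent_sub _)).
(* The quotient by <x> has order p^a, so the image of y is killed by p^a. *)
have /cycleP[k def_k] : y ^+ (p ^ a) \in <[x]>.
  have Nxy := subsetP nxG _ Gy.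
  apply: coset_idr; first by rewrite groupX.
  rewrite morphX //.
  have <- : #|dessin_group D / <[x]>| = (p ^ a)%N.
    by rewrite card_quotient // -divgS // oG -orderE ox mulKn.
  by apply: expg_cardG; apply: mem_quotient.
(* The order of y^(p^a) divides p^(b-a) because y^(p^b) = 1. *)
have [c le_c oya] : exists2 c, (c <= b - a)%N & #[y ^+ (p ^ a)] = (p ^ c)%N.
  apply/(dvdn_pfactor _ _ p_pr); rewrite order_dvdn -expgM -expnD subnKC //.
  by rewrite expG.
have le_cb := leq_trans le_c (leq_subr _ _).
(* From x^(k p^c) = 1 it follows that p^b divides k p^c. *)
have /dvdnP[e def_e] : (p ^ (b - c) %| k)%N.
  rewrite -(dvdn_pmul2r (pX_gt0 c)) -expnD subnK // -ox order_dvdn expgM.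
  by rewrite -def_k -oya expg_order.
(* The order of y^(p^a) is both p^c and p^c / gcd(p^c, e), so the gcd is 1. *)
exists c, e%:Z%R; have co_e : coprimez e (p ^ c)%N%:Z.
  move: oya; rewrite def_k def_e order_expg_pexp // => eq_div.
  have := divnK (dvdn_gcdl (p ^ c) e); rewrite eq_div => /eqP.
  by rewrite -[X in _ == X]muln1 eqn_pmul2l // coprimez_sym.
split; first by rewrite /ce_valid le_c.
apply: given_by_card => //; split; first by rewrite -ox expg_order.
- by rewrite expnD expgM -oya expg_order.
- by apply/eqP/commgP.
- by rewrite def_k def_e.
Qed.

(** If x and y have orders p^m and p^n, then p^max(m, n) kills the whole abelian group, in
    particular an element of order p^b; hence max(m, n) >= b. *)
Lemma has_group_type_order_max (p a b : nat) (D : dessin) : prime p ->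
    (a <= b)%N -> has_group_type p a b D ->
  #[dessin_x D] = (p ^ b)%N \/ #[dessin_y D] = (p ^ b)%N.
Proof.
move=> p_pr le_ab tD; have p_gt0 := prime_gt0 p_pr.
have [Gx Gy] := (mem_dessin_x D, mem_dessin_y D).
have cxy : commute (dessin_x D) (dessin_y D).
  exact: (centsP (has_group_type_abelian tD)).
have expG := has_group_type_exponent p_gt0 le_ab tD.
have [g] := has_group_type_order p_gt0 tD.
rewrite -dessin_gen => /(mem_gen2P _ cxy)[i [j ->]] og.
have ordP h : h \in dessin_group D -> exists2 m, (m <= b)%N & #[h] = (p ^ m)%N.
  by move=> Gh; apply/(dvdn_pfactor _ _ p_pr); rewrite order_dvdn expG.
have [m le_m ox] := ordP _ Gx; have [n le_n oy] := ordP _ Gy.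
suff le_b : (b <= maxn m n)%N.
  move: le_b; rewrite leq_max => /orP[le_b|le_b]; [left|right].
    by rewrite ox; congr (_ ^ _)%N; apply/eqP; rewrite eqn_leq le_m.
  by rewrite oy; congr (_ ^ _)%N; apply/eqP; rewrite eqn_leq le_n.
have kill (h : dessin_gT D) l :
    #[h] = (p ^ l)%N -> (l <= maxn m n)%N -> h ^+ (p ^ maxn m n) = 1.
  by move=> oh le_l; apply/eqP; rewrite -order_dvdn oh dvdn_exp2l.
rewrite -(dvdn_Pexp2l _ _ (prime_gt1 p_pr)) -og order_dvdn.
rewrite expgMn; last exact: commuteX2.
rewrite -!expgM ![(_ * p ^ _)%N]mulnC !expgM.
by rewrite (kill _ _ ox) ?(kill _ _ oy) ?leq_maxl ?leq_maxr // !expg1n mulg1.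
Qed.

(** * The isomorphism criterion and the finite type of pairs *)

(** The relations by themselves only bound the order of x; that p^b is attained is read off the
    isomorphic model, whose natural parameter is the residue of e mod p^c. *)
Lemma order_given_by (p a b c : nat) (e : int) (D : dessin) : (0 < p)%N ->
    (a <= b)%N -> (c <= b - a)%N -> given_by p a b c e D ->
  #[dessin_x D] = (p ^ b)%N.
Proof.
move=> p_gt0 le_ab le_c gD; have le_cb := leq_trans le_c (leq_subr _ _).
pose n := `|(e %% (p ^ c)%N%:Z)%Z|%N.
have gM : given_by p a b c e (ce_dessin p a b c n).
  apply: given_by_eqmod (given_by_ce_dessin _ _ _ _) => //.
  rewrite gez0_abs ?modz_mod // modz_ge0 // eqz_nat -lt0n expn_gt0 p_gt0 //.
by rewrite (order_dessin_iso (presented_by_iso gD gM)) order_ce_dessin.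
Qed.

(** An isomorphism carries the first relations to the second dessin, where both sets hold for the
    same x, y and [ce_relations_inj] applies. Conversely, congruent parameters give equivalent
    relations. *)
Lemma given_by_isoP (p a b c1 c2 : nat) (e1 e2 : int) (D1 D2 : dessin) :
    prime p -> (a <= b)%N ->
    ce_valid p a b c1 e1 -> ce_valid p a b c2 e2 ->
    given_by p a b c1 e1 D1 -> given_by p a b c2 e2 D2 ->
  dessin_iso D1 D2 <-> c1 = c2 /\ (e1 = e2 %[mod (p ^ c1)%N%:Z])%Z.
Proof.
move=> p_pr le_ab v1 v2 g1 g2; have p_gt0 := prime_gt0 p_pr.
have /andP[le_c1 _] := v1; have /andP[le_c2 _] := v2.
have le_cb := leq_trans le_c1 (leq_subr _ _).
split=> [iso12 | [eq_c eq_e]].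
  apply: ce_relations_inj (ce_relations_iso iso12 g1.1) g2.1 => //.
  exact: order_given_by g2.
subst c2; apply: presented_by_iso g2.
exact: given_by_eqmod g1.
Qed.

Lemma ce_pair_valid (p a b : nat) (q : ce_pair p a b) : prime p ->
  ce_valid p a b (pair_c q) (pair_e q).
Proof.
move=> p_pr; case: q => -[c lt_c] [u Uu]; rewrite /ce_valid /pair_c /pair_e /=.
rewrite -ltnS lt_c /= coprimez_sym.
(* For c = 0 the ring ['Z_1] is not the integers modulo p^c, but coprimality to 1 is automatic. *)
case: (posnP c) => [c0|c_gt0].
  have co_1 n : coprime (p ^ c) n by rewrite c0 coprime1n.
  exact: co_1.
have pc_gt1 : (1 < p ^ c)%N by rewrite -(expn0 p) ltn_exp2l ?prime_gt1.
by rewrite /= -(natr_Zp u) unitZpE in Uu.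
Qed.

Lemma ce_pair_surj (p a b c : nat) (e : int) : prime p ->
    ce_valid p a b c e ->
  exists q : ce_pair p a b,
    pair_c q = c /\ (e = pair_e q %[mod (p ^ c)%N%:Z])%Z.
Proof.
move=> p_pr /andP[le_c co_e]; have p_gt0 := prime_gt0 p_pr.
have lt_c : (c < (b - a).+1)%N by [].
case: (posnP c) => [c0|c_gt0].
  exists (Tagged (fun c : 'I_(b - a).+1 => {unit 'Z_(p ^ c)})
            (1 : {unit 'Z_(p ^ Ordinal lt_c)})).
  have mod_1 z : (z %% (p ^ c)%N%:Z)%Z = 0%R by rewrite c0 modz1.
  by split=> //; rewrite !mod_1.
have pc_gt1 : (1 < p ^ c)%N by rewrite -(expn0 p) ltn_exp2l ?prime_gt1.
pose n := `|(e %% (p ^ c)%N%:Z)%Z|%N.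
have Un : (n%:R : 'Z_(p ^ Ordinal lt_c))%R \is a GRing.unit.
  by rewrite unitZpE //= coprime_absz_modz // ltnW.
exists (Tagged (fun c : 'I_(b - a).+1 => {unit 'Z_(p ^ c)}) (FinRing.Unit Un)).
split=> //; rewrite /pair_e /= val_Zp_nat // -modz_nat modz_mod.
by rewrite gez0_abs ?modz_mod // modz_ge0 // eqz_nat -lt0n ltnW.
Qed.

Lemma ce_pair_inj (p a b : nat) (q1 q2 : ce_pair p a b) : prime p ->
  pair_c q1 = pair_c q2 ->
  (pair_e q1 = pair_e q2 %[mod (p ^ pair_c q1)%N%:Z])%Z -> q1 = q2.
Proof.
move=> p_pr; case: q1 q2 => c1 u1 [c2 u2]; rewrite /pair_c /pair_e /= => eq_c.
have {}eq_c := val_inj eq_c; subst c2.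
case: c1 u1 u2 => c lt_c /= u1 u2 eq_e.
congr (existT _ _ _); apply/val_inj.
(* For c = 0 the congruence modulo 1 says nothing; uniqueness comes from 1 being the only unit of
   the two-element ring ['Z_1]. *)
case: (posnP c) => [c0|c_gt0].
  have unit1 (u : {unit 'Z_(p ^ c)}) : \val u = 1%R.
    case: u => u /=; rewrite c0 in u *; case: u => -[|[|]] // lt_u.
    by move=> _; apply: val_inj.
  by rewrite !unit1.
have pc_gt1 : (1 < p ^ c)%N by rewrite -(expn0 p) ltn_exp2l ?prime_gt1.
apply/val_inj; move: eq_e; rewrite !modz_nat => -[].
by rewrite !modn_small // -[X in (_ < X)%N](Zp_cast pc_gt1) ltn_ord.
Qed.

Theorem theorem4p7 (p a b : nat) (p_prime : prime p) (le_ab : (a <= b)%N) :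
  [/\ forall D : dessin, has_group_type p a b D -> #[dessin_x D]%g = (p ^ b)%N ->
        exists (c : nat) (e : int) (D' : dessin),
          [/\ ce_valid p a b c e, given_by p a b c e D' & dessin_iso D D'],
      forall (c1 c2 : nat) (e1 e2 : int) (D1 D2 : dessin),
        ce_valid p a b c1 e1 -> ce_valid p a b c2 e2 ->
        given_by p a b c1 e1 D1 -> given_by p a b c2 e2 D2 ->
        (dessin_iso D1 D2 <->
         c1 = c2 /\ (e1 = e2 %[mod (p ^ c1)%N%:Z])%Z)
    & exists F : ce_pair p a b -> dessin,
        [/\ forall q, given_by p a b (pair_c q) (pair_e q) (F q),
            classifies
              (fun D => has_group_type p a b D /\ #[dessin_x D]%g = (p ^ b)%N) F
          & forall D : dessin, has_group_type p a b D ->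
              exists q, dessin_iso D (F q) \/ dessin_iso (dual D) (F q)]].
Proof.
have p_gt0 := prime_gt0 p_prime.
pose F (q : ce_pair p a b) :=
  ce_dessin p a b (pair_c q) (FinRing.uval (tagged q)).
have vq q := @ce_pair_valid p a b q p_prime.
have gF q : given_by p a b (pair_c q) (pair_e q) (F q).
  by apply: given_by_ce_dessin => //; have /andP[] := vq q.
have isoF D : has_group_type p a b D -> #[dessin_x D] = (p ^ b)%N ->
    exists! q, dessin_iso D (F q).
  move=> tD ox; have [c [e [v gD]]] := has_group_type_ce p_prime le_ab tD ox.
  have isoP q := given_by_isoP p_prime le_ab v (vq q) gD (gF q).
  have [q [eq_c eq_e]] := ce_pair_surj p_prime v.
  exists q; split=> [|q' /isoP[eq_c' eq_e']]; first by apply/isoP.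
  by apply: ce_pair_inj; rewrite // eq_c // -eq_e.
split.
- move=> D tD ox; have [c [e [v gD]]] := has_group_type_ce p_prime le_ab tD ox.
  (* D is itself the presented dessin; uniqueness of presented dessins applied to D twice supplies
     reflexivity. *)
  by exists c, e, D; split=> //; exact: (presented_by_iso gD gD).
- move=> c1 c2 e1 e2 D1 D2 v1 v2 g1 g2.
  exact: (given_by_isoP p_prime le_ab v1 v2 g1 g2).
exists F; split=> // [|D tD].
  split=> [q|D [tD ox]]; last exact: isoF.
  by split; [apply: has_group_type_ce_dessin | apply: order_ce_dessin].
case: (has_group_type_order_max p_prime le_ab tD) => o.
  by have [q [iso_q _]] := isoF D tD o; exists q; left.
(* [dual D] has the same group as D, and its x is the y of D, so [tD] and [o] apply to it by
   conversion. *)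
by have [q [iso_q _]] := isoF (dual D) tD o; exists q; right.
Qed.
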